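(* Let $d, M, n\in\mathbb{N}$ (positive integers). (1) Let $f\colon\mathbb{Z}^d\to\mathbb{C}$ be an $M$-sparse $d$-variate exponential sum with parameters $z_1,\dots,z_M\in\mathbb{C}_\ast^d$, and let $\Omega_f=\{z_1,\dots,z_M\}$. If $n\ge M$, then $$\Omega_f=V(\ker T_n(f)).$$ (2) Conversely, if the equality $\Omega_f=V(\ker T_n(f))$ holds for all $M$-sparse $d$-variate exponential sums $f\colon\mathbb{Z}^d\to\mathbb{C}$, then $n\ge M$.
   Context: Let $\mathbb{C}_\ast:=\mathbb{C}\setminus\{0\}$ and $\mathbb{C}_\ast^d:=(\mathbb{C}_\ast)^d$. For $z\in\mathbb{C}_\ast^d$ and $k\in\mathbb{Z}^d$ write $z^k:=z_1^{k_1}\cdots z_d^{k_d}$. A function $f\colon\mathbb{Z}^d\to\mathbb{C}$ is an $M$-sparse $d$-variate exponential sum with coefficients $\hat f_1,\dots,\hat f_M\in\mathbb{C}_\ast$ and pairwise distinct parameters $z_1,\dots,z_M\in\mathbb{C}_\ast^d$ if $f(k)=\sum_{j=1}^M\hat f_j z_j^k$ for all $k\in\mathbb{Z}^d$. (The number $M$, the coefficients and the parameters are then uniquely determined by $f$ up to order.) The set of parameters is denoted $\Omega_f$. Let $I_n:=\{0,\dots,n\}^d$ and $N:=|I_n|=(n+1)^d$. The matrix $T_n(f)\in\mathbb{C}^{N\times N}$ is indexed by $I_n\times I_n$ and has entry $f(k-\ell)$ in row $\ell\in I_n$ and column $k\in I_n$; that is, $(T_n(f)\hat p)_\ell=\sum_{k\in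 I_n}f(k-\ell)\hat p_k$ for $\hat p\in\mathbb{C}^{N}=\mathbb{C}^{I_n}$. A vector $\hat p=(\hat p_k)_{k\in I_n}\in\mathbb{C}^N$ is identified with the polynomial $p=\sum_{k\in I_n}\hat p_k Z_1^{k_1}\cdots Z_d^{k_d}\in\mathbb{C}[Z_1,\dots,Z_d]$, so $\ker T_n(f)$ is regarded as a set of polynomials. For a set $P$ of polynomials, $V(P):=\{z\in\mathbb{C}^d: p(z)=0\text{ for all }p\in P\}$. *)

(* Defs.v *)
From mathcomp Require Import all_boot all_order all_algebra.
From mathcomp Require Import classical_sets reals complex.
From mathcomp Require Import mpoly.

Set Implicit Arguments.
Unset Strict Implicit.
Unset Printing Implicit Defensive.

Import GRing.Theory.

Local Open Scope ring_scope.
Local Open Scope classical_set_scope.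
Local Open Scope complex_scope.

Definition zpow (R : realType) (d : nat) (z : 'rV[R[i]]_d) (k : 'rV[int]_d)
  : R[i] := \prod_(i < d) z 0 i ^ k 0 i.

(* [exp_sum f c z]: [f] is the [M]-sparse exponential sum whose coefficients
   are [c] and whose pairwise distinct parameters are [z].  The set of
   parameters of [f] is then [range z]. *)
Definition exp_sum (R : realType) (d M : nat) (f : 'rV[int]_d -> R[i])
    (c : 'I_M -> R[i]) (z : 'I_M -> 'rV[R[i]]_d) : Prop :=
  [/\ forall j, c j != 0,
      forall j i, z j 0 i != 0,
      injective z &
      forall k, f k = \sum_(j < M) c j * zpow (z j) k].

Definition box (d n : nat) : finType := {ffun 'I_d -> 'I_n.+1}.

Definition box_int (d n : nat) (k : box d n) : 'rV[int]_d :=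
  \row_(i < d) (k i : nat)%:Z.

Definition box_mnm (d n : nat) (k : box d n) : 'X_{1.. d} :=
  [multinom (k i : nat) | i < d].

(* Rows and columns are indexed by [box d n] through its enumeration
   [enum_val : 'I_#|box d n| -> box d n]. *)
Definition toeplitz (R : realType) (d n : nat) (f : 'rV[int]_d -> R[i])
  : 'M[R[i]]_#|box d n| :=
  \matrix_(l, k) f (box_int (enum_val k) - box_int (enum_val l)).

Definition vec_mpoly (R : realType) (d n : nat) (p : 'cV[R[i]]_#|box d n|)
  : {mpoly R[i][d]} :=
  \sum_(k < #|box d n|) p k 0 *: 'X_[box_mnm (enum_val k)].

(* The right kernel [T *m p = 0]; MathComp's [kermx] is the left kernel. *)
Definition toeplitz_ker (R : realType) (d n : nat) (f : 'rV[int]_d -> R[i])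
  : set {mpoly R[i][d]} :=
  @vec_mpoly R d n @` [set p | toeplitz n f *m p = 0].

Definition zero_locus (R : realType) (d : nat) (P : set {mpoly R[i][d]})
  : set 'rV[R[i]]_d :=
  [set w | forall p, P p -> p.@[fun i => w 0 i] = 0].

(* Main.v *)
(** Since [(T p)_l = \sum_j c_j z_j^-l p(z_j)], polynomials vanishing on the
    [z_j] are in the kernel. Pairing [T p = 0] with polynomials of degree at
    most [M - 1] which vanish at all [z_j] but one shows that, for [M <= n + 1],
    there are no others; a product of [M] linear factors then separates any
    other point from the [z_j]. For [M > n], parameters [z_j = (j + 1, 1, ..., 1)]
    with suitable positive weights still force kernel elements to vanish at the
    [z_j], hence, having degree at most [n] in the first variable, on the whole
    line through them. *)
Require Import Defs.
From mathcomp Require Import all_boot all_order all_algebra.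
From mathcomp Require Import classical_sets reals complex.
From mathcomp Require Import mpoly.

Set Implicit Arguments.
Unset Strict Implicit.
Unset Printing Implicit Defensive.

Import GRing.Theory Num.Theory.

Local Open Scope ring_scope.
Local Open Scope classical_set_scope.
Local Open Scope complex_scope.

Lemma zpowD (R : realType) (d : nat) (z : 'rV[R[i]]_d) (k l : 'rV[int]_d) :
  (forall i, z 0 i != 0) -> zpow z (k + l) = zpow z k * zpow z l.
Proof.
move=> z_neq0; rewrite /zpow -big_split; apply: eq_bigr => i _ /=.
by rewrite mxE expfzDr.
Qed.

Lemma zpow_neq0 (R : realType) (d : nat) (z : 'rV[R[i]]_d) (k : 'rV[int]_d) :
  (forall i, z 0 i != 0) -> zpow z k != 0.
Proof. by move=> z_neq0; apply/prodf_neq0 => i _; rewrite expfz_neq0. Qed.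

Lemma zpow_box_int (R : realType) (d n : nat) (z : 'rV[R[i]]_d) (k : box d n) :
  zpow z (box_int k) = \prod_(i < d) z 0 i ^+ k i.
Proof. by apply: eq_bigr => i _; rewrite mxE. Qed.

Lemma vec_mpoly_eval (R : realType) (d n : nat)
    (p : 'cV[R[i]]_#|box d n|) (z : 'rV[R[i]]_d) :
  (vec_mpoly p).@[fun i => z 0 i] =
  \sum_k p k 0 * zpow z (box_int (enum_val k)).
Proof.
rewrite /vec_mpoly raddf_sum; apply: eq_bigr => k _ /=.
rewrite mevalZ mevalX zpow_box_int; congr (_ * _).
by apply: eq_bigr => i _; rewrite mnmE.
Qed.

Lemma box_mnm_inj (d n : nat) : injective (@box_mnm d n).
Proof.
move=> k l /mnmP kl; apply/ffunP => i; apply: val_inj.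
by have := kl i; rewrite !mnmE.
Qed.

(** [msize] is the total degree plus one, and a total degree of at most [n] bounds every single
    exponent by [n], so the support lies in the box. *)
Lemma msize_le_vec_mpoly (R : realType) (d n : nat) (q : {mpoly R[i][d]}) :
  (msize q <= n.+1)%N -> exists v : 'cV[R[i]]_#|box d n|, vec_mpoly v = q.
Proof.
move=> sz_q; exists (\col_k q@_(box_mnm (enum_val k))).
apply/mpolyP => m; rewrite /vec_mpoly raddf_sum /=.
under eq_bigr do rewrite mcoeffZ mcoeffX mxE.
have [m_le|] := boolP [forall i, m i < n.+1]%N.
  pose k : box d n := [ffun i => inord (m i)].
  have km : box_mnm k = m.
    by apply/mnmP => i; rewrite mnmE ffunE inordK // (forallP m_le).
  rewrite (bigD1 (enum_rank k)) //= enum_rankK km eqxx mulr1.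
  rewrite big1 ?addr0 // => j jNk; rewrite -km (inj_eq (@box_mnm_inj d n)).
  rewrite (_ : _ == _ = false) ?mulr0 //; apply: contra_neqF jNk => /eqP <-.
  by rewrite enum_valK.
rewrite negb_forall => /existsP[a]; rewrite -leqNgt => n_lt.
have -> : q@_m = 0.
  apply/eqP; rewrite mcoeff_eq0; apply: msize_mdeg_ge.
  apply: leq_trans sz_q (leq_trans n_lt _).
  by rewrite mdegE (bigD1 a) //= leq_addr.
rewrite big1 // => k _; rewrite (_ : _ == m = false) ?mulr0 //.
apply/eqP => km; move: n_lt; rewrite -km mnmE.
by rewrite leqNgt ltn_ord.
Qed.

Definition box_rev (d n : nat) (k : box d n) : box d n :=
  [ffun i : 'I_d => rev_ord (k i)].

Lemma box_int_rev (d n : nat) (k : box d n) :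
  box_int (box_rev k) = const_mx n%:Z - box_int k.
Proof.
apply/rowP => i; rewrite !mxE ffunE /= subSS subzn //.
by rewrite -ltnS ltn_ord.
Qed.

Lemma toeplitz_mulE (R : realType) (d M n : nat) (f : 'rV[int]_d -> R[i])
    (c : 'I_M -> R[i]) (z : 'I_M -> 'rV[R[i]]_d)
    (p : 'cV[R[i]]_#|box d n|) l :
  exp_sum f c z ->
  (toeplitz n f *m p) l 0 =
  \sum_j c j * zpow (z j) (- box_int (enum_val l))
       * (vec_mpoly p).@[fun i => z j 0 i].
Proof.
case=> _ z_neq0 _ fE; rewrite mxE.
under eq_bigr do rewrite mxE fE mulr_suml.
rewrite exchange_big; apply: eq_bigr => j _ /=.
rewrite vec_mpoly_eval mulr_sumr; apply: eq_bigr => k _.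
by rewrite zpowD // -!mulrA; congr (_ * _); rewrite mulrCA; congr (_ * _); exact: mulrC.
Qed.

(* Reversing the box turns the negative powers [z^-l] into [z^-(n,...,n)] times
   a monomial of the box, so that the kernel is cut out by a symmetric form. *)
Lemma toeplitz_ker_pairing (R : realType) (d M n : nat)
    (f : 'rV[int]_d -> R[i]) (c : 'I_M -> R[i]) (z : 'I_M -> 'rV[R[i]]_d)
    (p q : 'cV[R[i]]_#|box d n|) :
  exp_sum f c z -> toeplitz n f *m p = 0 ->
  \sum_j c j * zpow (z j) (- const_mx n%:Z)
       * (vec_mpoly q).@[fun i => z j 0 i]
       * (vec_mpoly p).@[fun i => z j 0 i] = 0.
Proof.
move=> fcz Tp0; have [_ z_neq0 _ _] := fcz.
under eq_bigr do rewrite (vec_mpoly_eval q) mulr_sumr mulr_suml.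
rewrite exchange_big big1 // => k _ /=.
(* The term of [q k 0] comes from the row of the reversed index [(n,...,n) - k], where the power of
   [z j] splits as [z^-(n,...,n) * z^k]. *)
have := congr1 (fun v : 'cV_ _ => v (enum_rank (box_rev (enum_val k))) 0) Tp0.
rewrite /= (toeplitz_mulE _ _ fcz) enum_rankK box_int_rev mxE => sum0.
rewrite -[RHS](mulr0 (q k 0)) -[in RHS]sum0 mulr_sumr; apply: eq_bigr => j _.
rewrite opprB addrC zpowD // !mulrA; congr (_ * _ * _).
by rewrite mulrC !mulrA.
Qed.

(** Take one linear factor per point, in a coordinate [a] where that point differs from [w]; each
    factor raises the degree by one. *)
Lemma separating_mpoly (R : realType) (d : nat) (I : eqType) (s : seq I)
    (z : I -> 'rV[R[i]]_d) (w : 'rV[R[i]]_d) :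
  (forall j, j \in s -> z j != w) ->
  exists q : {mpoly R[i][d]},
    [/\ (msize q <= (size s).+1)%N,
        forall j, j \in s -> q.@[fun i => z j 0 i] = 0
      & q.@[fun i => w 0 i] != 0].
Proof.
elim: s => [|j s IHs] zNw.
  by exists 1; split=> //; rewrite ?msize1 ?meval1 ?oner_neq0.
have [q [sz_q q_z q_w]] : exists q : {mpoly R[i][d]},
    [/\ (msize q <= (size s).+1)%N,
        forall j, j \in s -> q.@[fun i => z j 0 i] = 0
      & q.@[fun i => w 0 i] != 0].
  by apply: IHs => k ks; rewrite zNw // inE ks orbT.
have /rV0Pn [a] : z j - w != 0 by rewrite subr_eq0 zNw // mem_head.
rewrite !mxE subr_eq0 eq_sym => wa.
pose l : {mpoly R[i][d]} := 'X_a - (z j 0 a)%:MP.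
have l_w : l.@[fun i => w 0 i] != 0 by rewrite mevalB mevalXU mevalC subr_eq0.
exists (l * q); split; last by rewrite mevalM mulf_neq0.
(* The formula for the degree of a product asks for nonzero factors, and both are nonzero at [w]. *)
- have neq0 (r : {mpoly R[i][d]}) : r.@[fun i => w 0 i] != 0 -> r != 0.
    by apply: contra_neq => ->; rewrite meval0.
  have sz_l : (msize l <= 2)%N.
    rewrite (leq_trans (mmeasureD_le _ _ _)) // mmeasureN msizeX mdeg1 mmeasureC.
    by case: eqP.
  by rewrite msizeM ?neq0 // -ltnS prednK ?(leq_add sz_l) // addn_gt0
     lt0n mmeasure_poly_eq0 neq0.
- move=> k; rewrite inE mevalM => /orP [/eqP ->|/q_z ->]; last by rewrite mulr0.
  by rewrite mevalB mevalXU mevalC subrr mul0r.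
Qed.

(** A test polynomial vanishing at the other [M - 1] points has degree at most [M - 1 <= n], so it
    fits in the box; the pairing then keeps only the [j]-th term, whose other factors are
    nonzero. *)
Lemma toeplitz_ker_root (R : realType) (d M n : nat) (f : 'rV[int]_d -> R[i])
    (c : 'I_M -> R[i]) (z : 'I_M -> 'rV[R[i]]_d)
    (p : 'cV[R[i]]_#|box d n|) (j : 'I_M) :
  exp_sum f c z -> (M <= n.+1)%N -> toeplitz n f *m p = 0 ->
  (vec_mpoly p).@[fun i => z j 0 i] = 0.
Proof.
move=> fcz leMn Tp0; have [c_neq0 z_neq0 z_inj _] := fcz.
have [k|q [sz_q q_z q_zj]] := @separating_mpoly R d _ (rem j (enum 'I_M)) z (z j).
  by rewrite (rem_filter _ (enum_uniq _)) mem_filter (inj_eq z_inj) => /andP [].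
have [|v vq] := @msize_le_vec_mpoly R d n q.
  rewrite (leq_trans sz_q) // size_rem ?mem_enum // size_enum_ord prednK //.
  by case: j {q_z q_zj sz_q} => ? /(leq_ltn_trans _) ->.
have := toeplitz_ker_pairing v fcz Tp0; rewrite vq (bigD1 j) //=.
rewrite big1 ?addr0 => [/eqP|k kNj].
  rewrite !mulf_eq0 (negPf (c_neq0 j)) (negPf (zpow_neq0 _ (z_neq0 j))).
  by rewrite (negPf q_zj) /= => /eqP.
rewrite q_z ?mulr0 ?mul0r // (rem_filter _ (enum_uniq _)) mem_filter /= kNj.
exact: mem_enum.
Qed.

Lemma range_eq_zero_locus (R : realType) (d M n : nat) (f : 'rV[int]_d -> R[i])
    (c : 'I_M -> R[i]) (z : 'I_M -> 'rV[R[i]]_d) :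
  exp_sum f c z -> (M <= n)%N -> range z = zero_locus (toeplitz_ker n f).
Proof.
move=> fcz leMn; apply/seteqP; split=> [_ [j _ <-] _ [p Tp0 <-]|w w0].
  exact: (toeplitz_ker_root _ fcz (leqW leMn) Tp0).
have [//|wNz] := boolp.EM (range z w).
(* Now all [M] points are removed, which needs degree [M] and hence [M <= n] rather than
   [M <= n + 1]. *)
have [j _|q [sz_q q_z q_w]] := @separating_mpoly R d _ (enum 'I_M) z w.
  by apply/eqP => zjw; apply: wNz; exists j.
have [|v vq] := @msize_le_vec_mpoly R d n q.
  by rewrite (leq_trans sz_q) // size_enum_ord.
case/eqP: q_w; apply: w0; exists v => //.
apply/colP => l; rewrite (toeplitz_mulE _ _ fcz) mxE big1 // => j _.
by rewrite vq q_z ?mulr0 ?mem_enum.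
Qed.

Definition axis_point (R : realType) (d : nat) (i0 : 'I_d) (t : R[i])
  : 'rV[R[i]]_d := \row_i (if i == i0 then t else 1).

Lemma axis_point_inj (R : realType) (d : nat) (i0 : 'I_d) :
  injective (@axis_point R d i0).
Proof. by move=> t u /rowP /(_ i0); rewrite !mxE eqxx. Qed.

Lemma vec_mpoly_axis (R : realType) (d n : nat) (i0 : 'I_d)
    (p : 'cV[R[i]]_#|box d n|) :
  exists2 P : {poly R[i]}, (size P <= n.+1)%N &
    forall t, P.[t] = (vec_mpoly p).@[fun i => axis_point i0 t 0 i].
Proof.
exists (\sum_k p k 0 *: 'X^(enum_val k i0)).
  rewrite (leq_trans (size_sum _ _ _)) //; apply/bigmax_leqP => k _.
  by rewrite (leq_trans (size_scale_leq _ _)) // size_polyXn.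
move=> t; rewrite vec_mpoly_eval horner_sum; apply: eq_bigr => k _.
rewrite hornerZ hornerXn zpow_box_int (bigD1 i0) //= mxE eqxx big1 ?mulr1 //.
by move=> i iNi0; rewrite mxE (negPf iNi0) expr1n.
Qed.

(* With [z j] real and [c j = z j ^ (n,...,n)] the pairing of
   [toeplitz_ker_pairing] is [\sum_j q (z j) * p (z j)], and taking for [q] the
   conjugate of [p] makes it a sum of squares. *)
Lemma real_toeplitz_ker_root (R : realType) (d M n : nat)
    (f : 'rV[int]_d -> R[i]) (z : 'I_M -> 'rV[R[i]]_d)
    (p : 'cV[R[i]]_#|box d n|) (j : 'I_M) :
  (forall j i, z j 0 i \is Num.real) ->
  exp_sum f (fun j => zpow (z j) (const_mx n%:Z)) z -> toeplitz n f *m p = 0 ->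
  (vec_mpoly p).@[fun i => z j 0 i] = 0.
Proof.
move=> z_real fz Tp0; have [_ z_neq0 _ _] := fz.
pose q := map_mx Num.conj p.
have qE k : (vec_mpoly q).@[fun i => z k 0 i]
    = Num.conj (vec_mpoly p).@[fun i => z k 0 i].
  rewrite !vec_mpoly_eval rmorph_sum; apply: eq_bigr => l _ /=.
  rewrite rmorphM mxE !zpow_box_int rmorph_prod; congr (_ * _).
  by apply: eq_bigr => i _; rewrite rmorphXn /= conj_Creal.
have := toeplitz_ker_pairing q fz Tp0.
under eq_bigr => k _.
  rewrite -zpowD // subrr qE /zpow big1 ?mul1r; last first.
    by move=> i _; rewrite mxE expr0z.
  rewrite mulrC -normCK; over.
move/(psumr_eq0P (fun k _ => exprn_ge0 2 (normr_ge0 _)))/(_ j isT)/eqP.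
by rewrite expf_eq0 normr_eq0 => /eqP.
Qed.

Theorem theorem3p1 (R : realType) (d M n : nat)
    (hd : (0 < d)%N) (hM : (0 < M)%N) (hn : (0 < n)%N) :
  (forall (f : 'rV[int]_d -> R[i]) (c : 'I_M -> R[i])
      (z : 'I_M -> 'rV[R[i]]_d),
    exp_sum f c z -> (M <= n)%N ->
    range z = zero_locus (toeplitz_ker n f)) /\
  ((forall (f : 'rV[int]_d -> R[i]) (c : 'I_M -> R[i])
      (z : 'I_M -> 'rV[R[i]]_d),
    exp_sum f c z -> range z = zero_locus (toeplitz_ker n f)) ->
   (M <= n)%N).
Proof.
split; first exact: range_eq_zero_locus.
move=> all_eq; rewrite leqNgt; apply/negP => ltnM.
(* The shift to [j.+1] keeps all coordinates nonzero. *)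
pose i0 := Ordinal hd; pose z (j : 'I_M) := axis_point i0 (j.+1%:R : R[i]).
pose c j := zpow (z j) (const_mx n%:Z).
pose f k := \sum_j c j * zpow (z j) k.
have z_neq0 j i : z j 0 i != 0.
  by rewrite mxE; case: (i == i0); rewrite ?oner_neq0 ?pnatr_eq0.
have z_real j i : z j 0 i \is Num.real.
  by rewrite mxE; case: (i == i0); rewrite ?realn ?real1.
have fcz : exp_sum f c z.
  split=> // [j|j k /axis_point_inj /eqP]; first exact: zpow_neq0.
  by rewrite eqr_nat eqSS => /eqP /val_inj.
(* The point of the line with [t = 0] is no parameter, yet the kernel will be seen to vanish
   there. *)
have : range z (axis_point i0 0).
  rewrite (all_eq f c z fcz) => _ [p Tp0 <-].
  have [P sz_P PE] := vec_mpoly_axis i0 p; rewrite -PE.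
  suff -> : P = 0 by rewrite horner0.
  (* [P] has degree at most [n < M] but [M] distinct roots. *)
  apply: (@roots_geq_poly_eq0 _ _ [seq (j.+1%:R : R[i]) | j : 'I_M]).
  - apply/allP => _ /mapP [j _ ->]; rewrite rootE PE.
    by rewrite (real_toeplitz_ker_root j z_real fcz Tp0).
  - rewrite map_inj_uniq ?enum_uniq // => j k /eqP.
    by rewrite eqr_nat eqSS => /eqP /val_inj.
  - by rewrite size_map size_enum_ord (leq_trans sz_P).
by case=> j _ /axis_point_inj /eqP; rewrite pnatr_eq0.
Qed.
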